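(* Let $X$ be a zero-dimensional and locally compact space which is not pseudocompact. If $X$ has a partition of length $\kappa$, then the cellularity of each of the subspaces $\beta_0X\setminus\upsilon_0X$ and $\beta_0X\setminus X$ is at least $\kappa^{\aleph_0}$.
   Context: A zero-dimensional space is a Hausdorff topological space with a base of clopen sets. A space is pseudocompact if every continuous real-valued function on it is bounded. The Banaschewski compactification $\beta_0X$ of a zero-dimensional space $X$ is the (unique up to homeomorphism) compact zero-dimensional space containing $X$ as a dense subspace such that every continuous function $X\to\{0,1\}$ extends continuously to $\beta_0X$. A space is $\mathbb{N}$-compact if it is homeomorphic to a closed subspace of $\mathbb{N}^\lambda$ for some cardinal $\lambda$ ($\mathbb{N}$ discrete). $\upsilon_0X$ is the $\mathbb{N}$-compact space containing $X$ as a dense subspace such that every continuous function $X\to\mathbb{Z}$ extends continuously to $\upsilon_0X\to\mathbb{Z}$; it is regarded as a subspace $X\subseteq\upsilon_0X\subseteq\beta_0X$, namely the set of $p\in\beta_0X$ such that the ultrafilter of clopen sets $\{U\subseteq X \text{ clopen}: p\in\mathrm{cl}_{\beta_0X}U\}$ has the countable intersection property. For a cardinal $\kappa$, a partition of $X$ of length $\kappa$ is a family $\{U_i:i\in I\}$ of pairwise disjoint nonempty clopen subsets of $X$ whose union is $X$, with $|I|=\kappa$. The cellularity $c(Y)$ of a space $Y$ is the smallest cardinal $\lambda$ such that every pairwise disjoint family of nonempty open subsets of $Y$ has $\lambda$ or fewer members. *)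

(* Defs.v *)
From HB Require Import structures.
From mathcomp Require Import all_boot all_order all_algebra.
From mathcomp Require Import all_classical all_reals topology normedtype.

Set Implicit Arguments.
Unset Strict Implicit.
Unset Printing Implicit Defensive.

Import numFieldNormedType.Exports.
Local Open Scope classical_set_scope.
Local Open Scope card_scope.

(* This is stronger than the library's [zero_dimensional], which only asks
   that any two distinct points be separated by a clopen set. *)
Definition zero_dim_space (X : topologicalType) : Prop :=
  hausdorff_space X /\ basis [set U : set X | clopen U].

Definition pseudocompact (R : realType) (X : topologicalType) : Prop :=
  forall f : X -> R, continuous f -> [bounded f x | x in [set: X]].

Definition clopen_partition (X : topologicalType) (I : Type)
    (U : I -> set X) : Prop :=
  [/\ forall i, clopen (U i),
      forall i, U i !=set0,
      trivIset [set: I] U &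
      \bigcup_i U i = [set: X]].

Definition topological_embedding (X Y : topologicalType) (e : X -> Y) : Prop :=
  injective e /\
  forall U : set X, open U <-> exists2 V : set Y, open V & e @^-1` V = U.

(* [e : X -> B] exhibits [B] as the Banaschewski compactification of [X];
   [X] is identified with [range e]. *)
Definition banaschewski_compactification (X B : topologicalType)
    (e : X -> B) : Prop :=
  [/\ compact [set: B],
      zero_dim_space B,
      topological_embedding e,
      dense (range e) &
      forall f : X -> bool, continuous f ->
        exists2 g : B -> bool, continuous g & forall x, g (e x) = f x].

Definition clopen_trace (X B : topologicalType) (e : X -> B) (p : B) :
    set (set X) :=
  [set U | clopen U /\ closure (e @` U) p].

Definition countable_intersection_property (X : Type)
    (G : set (set X)) : Prop :=
  forall F : set (set X), F `<=` G -> countable F ->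
    \bigcap_(U in F) U !=set0.

Definition upsilon0 (X B : topologicalType) (e : X -> B) : set B :=
  [set p | countable_intersection_property (clopen_trace e p)].

Definition cellular_family (Y : topologicalType) (F : set (set Y)) : Prop :=
  (forall U, F U -> open U /\ U !=set0) /\ trivIset F id.

Definition cellular_bound (Y : topologicalType) (T : Type) (L : set T) : Prop :=
  forall F : set (set Y), cellular_family F -> F #<= L.

Definition is_cellularity (Y : topologicalType) (T : Type) (L : set T) : Prop :=
  cellular_bound Y L /\
  forall (T' : Type) (M : set T'), cellular_bound Y M -> L #<= M.

(* Cardinals are represented by sets up to equipotence; the representative of
   the cellularity is taken among the sets of subsets of [Y]. It is correctly
   defined by [cellularityP] below. *)
Definition cellularity (Y : topologicalType) : set (set Y) :=
  xget set0 [set L : set (set Y) | is_cellularity Y L].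

Arguments cellularity Y : clear implicits.

Lemma least_card (J : Type) (T : J -> Type) (A : forall j, set (T j)) (j0 : J) :
  exists i, forall j, A i #<= A j.
Proof.
pose P : set (set (forall j, T j)) := [set F |
  (forall f, F f -> forall j, A j (f j)) /\
  (forall f g j, F f -> F g -> f j = g j -> f = g)].
have [G GP Gtot|F [[FA Finj] Fmax]] := @Zorn_bigcup _ P.
  split=> [f [X GX Xf] j|f g j [X GX Xf] [Y GY Yg] fg].
    exact: (GP _ GX).1.
  have [XY|YX] := Gtot _ _ GX GY.
    exact: (GP _ GY).2 (XY _ Xf) Yg fg.
  exact: (GP _ GX).2 Xf (YX _ Yg) fg.
have [i iP] : exists i, A i `<=` (fun f => f i) @` F.
  apply: contrapT => /forallNP noi.
  have hP j : {a | A j a /\ ~ ((fun f => f j) @` F) a}.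
    apply: cid; apply: contrapT => /forallNP na; apply: (noi j) => a Aa.
    by apply: contrapT => Fa; exact: (na a).
  pose h j := sval (hP j).
  have hA j : A j (h j) by exact: (svalP (hP j)).1.
  have hF j f : F f -> f j <> h j.
    by move=> Ff fh; apply: (svalP (hP j)).2; exists f.
  apply: (Fmax (F `|` [set h])).
    split; first exact: subsetUl.
    by move=> /(_ h (or_intror erefl)) /(hF j0); apply.
  split=> [f [/FA//|-> //]|f g j [Ff|->] [Fg|->] //].
  - exact: Finj.
  - by move=> /(hF _ _ Ff).
  - by move=> /esym /(hF _ _ Fg).
exists i => j; apply: (card_le_trans (subset_card_le iP)).
apply: (card_le_trans (card_image_le _ _)).
have FF : F #<= (fun f => f j) @` F.
  have /card_eqPle[] // : (fun f => f j) @` F #= F.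
  by apply: inj_card_eq => f g /set_mem Ff /set_mem Fg; exact: Finj.
apply: (card_le_trans FF); apply: subset_card_le.
by move=> _ [f /FA Af <-].
Qed.

Lemma cellularityP (Y : topologicalType) :
  is_cellularity Y (cellularity Y).
Proof.
apply: (@xgetPex _ set0 [set L : set (set Y) | is_cellularity Y L]).
have bT : cellular_bound Y [set: set Y] by move=> F _; exact: card_leT.
have [[L bL] /= Lmin] := @least_card {L : set (set Y) | cellular_bound Y L}
  (fun=> set Y) (fun L => sval L) (exist _ _ bT).
exists L; split=> // T' M bM.
have [[] cmp] := @least_card bool (fun b => if b then set Y else T')
  (fun b => if b as b return set (if b then set Y else T') then L else M) true.
  exact: (cmp false).
have /card_leP[f] := cmp true.
pose M' : set (set Y) := [set sval (f x) | x in [set: M]].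
have /card_eqPle[M'M MM'] : M' #= M.
  apply: card_eq_trans (card_setT M); apply: inj_card_eq => x y _ _ /val_inj.
  by apply: (@inj _ _ _ f); rewrite inE.
have bM' : cellular_bound Y M' by move=> F /bM FM; exact: card_le_trans FM MM'.
exact: card_le_trans (Lmin (exist _ _ bM')) M'M.
Qed.

(* Main.v *)
Require Import Defs.
From mathcomp Require Import all_boot all_order all_algebra.
From mathcomp Require Import all_classical all_reals topology normedtype.
From mathcomp Require Import lra.

Import Order.TTheory GRing.Theory Num.Theory numFieldNormedType.Exports.

(** The remainder contains a large disjoint family of traces of clopen sets,
    coming from an almost disjoint family of clopen subsets of [X].

    Suppose first that the index set [I] of the partition is infinite. Then the
    finite sequences over [I] can be coded injectively by elements of [I]
    ([infinite_seq_inj]), so distinct pieces of the partition can be attached to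
    the nodes of the tree of finite sequences. Local compactness gives a
    nonempty compact clopen set [K s] inside the piece of each node [s]
    ([sub_compact_clopen]). A branch
    [f : nat -> I] yields the union [A f] of the sets [K s] for [s] an initial
    segment of [f]. It is clopen, because the pieces of the partition form a
    locally finite family ([clopen_bigcup_partition]), and therefore it is the
    trace on [X] of a clopen subset [W f] of the compactification
    ([clopen_extension]).

    - Two distinct branches share finitely many initial segments, so
      [A f `&` A h] lies in a compact subset of [X]; by density [W f `&` W h]
      lies in the image of that compact set, hence in [X]
      ([open_sub_compact_image]). So the [W f] have pairwise disjoint traces on
      the remainder.
    - Dropping longer and longer initial parts of the union [A f] gives a
      decreasing sequence of nonempty clopen sets with empty intersection. A
      point of the compactification adherent to all of them belongs to [W f],
      and its clopen ultrafilter does not have the countable intersection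
      property ([remainder_point]). So each trace is nonempty, even outside
      [upsilon0 e].

    There are as many branches as functions [nat -> I], and both subspaces
    are handled at once: the argument applies to the complement of any set
    between [range e] and [upsilon0 e] ([remainder_cellularity]).

    If [I] is finite, the hypothesis that [X] is not pseudocompact provides
    another clopen partition, indexed by [nat] ([unbounded_partition]), and
    finite sequences over [I] are coded by natural numbers. *)

Set Implicit Arguments.
Unset Strict Implicit.
Unset Printing Implicit Defensive.

Local Open Scope classical_set_scope.
Local Open Scope card_scope.

(** * Coding finite sequences over an infinite set *)

(** Well-ordering of cardinals, applied to a family of two. *)
Lemma card_le_total (T U : Type) (A : set T) (B : set U) :
  A #<= B \/ B #<= A.
Proof.
have [[] cmp] := @least_card bool (fun b => if b then T else U)
  (fun b => if b as b return set (if b then T else U) then A else B) true.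
- by left; exact: (cmp false).
- by right; exact: (cmp true).
Qed.

Lemma card_le_inj_fun (T U : Type) (A : set T) (B : set U) (d : T -> U) :
  A #<= B -> exists f : T -> U, (forall x, A x -> B (f x)) /\
    (forall x y, A x -> A y -> f x = f y -> x = y).
Proof.
move=> /card_leP[g].
exists (fun x => if pselect (A x) is left Ax
                 then sval (g (SigSub (mem_set Ax))) else d x).
split=> [x Ax|x y Ax Ay]; case: pselect => // Ax'.
  by have := svalP (g (SigSub (mem_set Ax'))); rewrite inE.
case: pselect => // Ay' /val_inj E.
have : SigSub (mem_set Ax') = SigSub (mem_set Ay') :> A.
  by apply: (@inj _ _ _ g) => //; rewrite inE.
by move/(congr1 sval).
Qed.

(** The encoding by a total function avoids dependent types when codings are
    extended or glued. *)
Definition seq_coding (I : eqType) (A : set I) (phi : seq I -> I) :=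
  (forall s : seq I, [set` s] `<=` A -> A (phi s)) /\
  (forall s t : seq I, [set` s] `<=` A -> [set` t] `<=` A ->
    phi s = phi t -> s = t).

Definition coding_extends (I : eqType) (p q : set I * (seq I -> I)) :=
  p.1 `<=` q.1 /\ forall s : seq I, [set` s] `<=` p.1 -> q.2 s = p.2 s.

(** Codings glue along a chain because a finite sequence over the union of a
    nonempty chain of sets is already a sequence over one of them. *)
Lemma seq_coding_chain (I : eqType) (C : set (set I * (seq I -> I))) :
  C !=set0 -> (forall p, C p -> seq_coding p.1 p.2) ->
  total_on C (@coding_extends I) ->
  exists2 q, seq_coding q.1 q.2 & forall p, C p -> coding_extends p q.
Proof.
move=> [p0 Cp0] Ccode Ctot.
pose A := \bigcup_(p in C) p.1.
pose phi (s : seq I) :=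
  if pselect (exists p, C p /\ [set` s] `<=` p.1) is left H
  then (sval (cid H)).2 s else p0.2 s.
have phiE p (s : seq I) : C p -> [set` s] `<=` p.1 -> phi s = p.2 s.
  move=> Cp sp; rewrite /phi; case: pselect => [H|[]]; last by exists p.
  case: (svalP (cid H)) => Cq sq.
  by have [[_ ->]|[_ ->]] := Ctot _ _ Cp Cq.
have seqA (s t : seq I) : [set` s] `<=` A -> [set` t] `<=` A ->
    exists p, [/\ C p, [set` s] `<=` p.1 & [set` t] `<=` p.1].
  move=> sA tA.
  have : [set` s ++ t] `<=` A.
    by move=> x /=; rewrite mem_cat => /orP[/sA|/tA].
  suff H (u : seq I) : [set` u] `<=` A -> exists2 p, C p & [set` u] `<=` p.1.
    move=> /H[p Cp stp]; exists p; split=> // x xs;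
      by apply: stp; rewrite /= mem_cat xs ?orbT.
  elim: u => [|x u IH] xuA; first by exists p0.
  have [p Cp up] : exists2 p, C p & [set` u] `<=` p.1.
    by apply: IH => y yu; apply: xuA; rewrite /= inE (yu : y \in u) orbT.
  have [q Cq qx] := xuA x (mem_head _ _).
  have [[pq _]|[qp _]] := Ctot _ _ Cp Cq.
    by exists q => // y /=; rewrite inE => /orP[/eqP ->//|/up /pq].
  by exists p => // y /=; rewrite inE => /orP[/eqP ->|/up//]; exact: qp.
exists (A, phi) => [|p Cp]; split=> //=.
- move=> s sA; have [p [Cp sp _]] := seqA _ _ sA sA.
  by rewrite (phiE p) //; exists p => //; exact: (Ccode _ Cp).1.
- move=> s t sA tA; have [p [Cp sp tp]] := seqA _ _ sA tA.
  by rewrite !(phiE p) //; exact: (Ccode _ Cp).2.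
- by move=> x px; exists p.
- by move=> s; exact: phiE.
Qed.

Lemma seq_coding_range (I : eqType) (h : nat -> I) :
  injective h -> exists phi, seq_coding (range h) phi.
Proof.
move=> hinj.
pose hinv x := xget 0 [set n | h n = x].
have hinvK x : range h x -> h (hinv x) = x.
  by move=> [n _ hn]; apply: (@xgetPex _ 0 [set n | h n = x]); exists n.
exists (fun s => h (pickle (map hinv s))).
split=> [s _|s t sh th /hinj /(pcan_inj pickleK) /(congr1 (map h))].
  by eexists.
by rewrite -!map_comp !map_id_in // => x xs; apply: hinvK;
  [exact: th|exact: sh].
Qed.

(** A coding on [A] provides two distinct elements [a0], [a1] and codes of
    pairs, so [A] has room for two copies of itself, namely the codes of
    [[:: a0; x]] and of [[:: a1; x]]. If [C] injects in [A], the set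
    [A `|` C] therefore injects in [A], and sequences over it can be coded
    entry by entry. *)
Lemma seq_coding_setU (I : eqType) (A : set I) (phi : seq I -> I)
    (C : set I) (k : I -> I) :
  seq_coding A phi ->
  (forall x, C x -> A (k x)) ->
  (forall x y, C x -> C y -> k x = k y -> x = y) ->
  exists psi, [/\ forall s : seq I, [set` s] `<=` A `|` C -> A (psi s) &
    forall s t : seq I, [set` s] `<=` A `|` C -> [set` t] `<=` A `|` C ->
      psi s = psi t -> s = t].
Proof.
move=> [phiA phi_inj] kA kinj.
pose a0 := phi [::]; have Aa0 : A a0 by apply: phiA.
pose a1 := phi [:: a0].
have sub1 : [set` [:: a0]] `<=` A by move=> x /=; rewrite inE => /eqP ->.
have Aa1 : A a1 by exact: phiA.
have sub2 a x : A a -> A x -> [set` [:: a; x]] `<=` A.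
  by move=> Aa Ax y /=; rewrite !inE => /orP[]/eqP->.
have a01 : a0 <> a1 by move=> /phi_inj E; have : [::] = [:: a0] by apply: E.
pose j x := if `[< A x >] then phi [:: a0; x] else phi [:: a1; k x].
have jA x : (A `|` C) x -> A (j x).
  rewrite /j; case: asboolP => [Ax _|nAx [//|/kA Akx]];
    by apply: phiA; apply: sub2.
have jinj x y : (A `|` C) x -> (A `|` C) y -> j x = j y -> x = y.
  have inj2 a b u v : A a -> A b -> A u -> A v ->
      phi [:: a; u] = phi [:: b; v] -> a = b /\ u = v.
    move=> Aa Ab Au Av /phi_inj E.
    by have [] : [:: a; u] = [:: b; v] by apply: E; exact: sub2.
  rewrite /j; case: asboolP => [Ax _|nAx [//|Cx]];
    case: asboolP => [Ay _|nAy [//|Cy]] /inj2[] //; try exact: kA.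
    by move=> /esym.
  by move=> _ /kinj; exact.
have mapjA (s : seq I) : [set` s] `<=` A `|` C -> [set` map j s] `<=` A.
  by move=> sAC _ /mapP[x xs ->]; apply: jA; exact: sAC.
exists (fun s => phi (map j s)); split=> [s /mapjA /phiA //|s t sAC tAC].
move=> /(phi_inj _ _ (mapjA _ sAC) (mapjA _ tAC)).
elim: s t sAC tAC => [|x s IH] [|y t] //= sAC tAC [jxy jst].
congr (_ :: _).
  by apply: jinj jxy; [apply: sAC|apply: tAC]; rewrite /= mem_head.
by apply: IH => // z zs; [apply: sAC|apply: tAC];
  rewrite /= inE (zs : z \in _) orbT.
Qed.

(** Zorn's lemma gives a maximal coding, on some [A]. If the complement of [A]
    injects in [A], then sequences over the whole type are coded in [A].
    Otherwise [A] has a disjoint copy [C], and sequences over [A `|` C] that are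
    not over [A] can be coded in [C], contradicting maximality. *)
Lemma infinite_seq_inj (I : Type) :
  infinite_set [set: I] -> exists f : seq I -> I, injective f.
Proof.
move=> infI; have /infiniteP natI := infI.
have [i0 _] : [set: I] !=set0.
  by apply/set0P/eqP => I0; apply: infI; rewrite I0.
have [h [_ hinj]] := card_le_inj_fun (fun=> i0) natI.
pose J : eqType := {classic I}.
suff [f finj] : exists f : seq J -> J, injective f by exists f.
have {hinj} hinj : injective (h : nat -> J) by move=> m n; exact: hinj.
have [phi0 phi0P] := seq_coding_range hinj.
pose T := {p : set J * (seq J -> J) | seq_coding p.1 p.2}.
pose R (p q : T) := `[< coding_extends (sval p) (sval q) >].
have [] := @ZL_preorder T (exist _ (_, _) phi0P) R.
- by move=> p; apply/asboolP; split.
- move=> q p r /asboolP[pq1 pq2] /asboolP[qr1 qr2]; apply/asboolP; split.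
    exact: subset_trans qr1.
  by move=> s sp; rewrite qr2 ?pq2//; exact: subset_trans pq1.
- move=> C Ctot; have [->|C0] := eqVneq C set0.
    by exists (exist _ (_, _) phi0P).
  have [||_ _ [p Cp <-] [q Cq <-]|q qP ub] :=
      @seq_coding_chain J (sval @` C).
  + by move/set0P: C0 => [p Cp]; exists (sval p); exists p.
  + by move=> _ [p _ <-]; exact: (svalP p).
  + by have [/asboolP|/asboolP] := Ctot _ _ Cp Cq; [left|right].
  exists (exist _ q qP) => p Cp; apply/asboolP; apply: ub.
  by exists p.
move=> [[A phi] /= Aphi] Amax.
have [AcA|AAc] := card_le_total (~` A) A.
  have [k [kA kinj]] := card_le_inj_fun id AcA.
  have [psi [_ psi_inj]] := seq_coding_setU Aphi kA kinj.
  exists psi => s t; apply: psi_inj => x _; rewrite setUv//.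
have [l [lA linj]] := card_le_inj_fun id AAc.
pose C := l @` A.
pose k x := xget x [set a | A a /\ l a = x].
have kP x : C x -> A (k x) /\ l (k x) = x.
  move=> [a Aa lax].
  by apply: (@xgetPex _ x [set a | A a /\ l a = x]); exists a.
have [||psi [psiA psi_inj]] := @seq_coding_setU _ A phi C k Aphi.
- by move=> x /kP[].
- by move=> x y /kP[_ kx] /kP[_ ky] kxy; rewrite -kx kxy.
pose phi' (s : seq J) := if `[< [set` s] `<=` A >] then phi s else l (psi s).
have AC x : A x -> ~ C x by move=> Ax [a /lA + lax]; rewrite lax.
have phi'P : seq_coding (A `|` C) phi'.
  split=> [s sAC|s t sAC tAC].
    rewrite /phi'; case: asboolP => [/(Aphi.1)|_]; first by left.
    by right; exists (psi s) => //; exact: psiA.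
  have Al (u : seq J) : [set` u] `<=` A `|` C -> C (l (psi u)).
    by move=> /psiA Au; exists (psi u).
  rewrite /phi'; case: asboolP => [sA|_]; case: asboolP => [tA|_].
  - exact: Aphi.2.
  - by move=> E; case: (AC (phi s)); [exact: Aphi.1|rewrite E; exact: Al].
  - by move=> E; case: (AC (phi t)); [exact: Aphi.1|rewrite -E; exact: Al].
  - by move=> /linj E; apply: psi_inj => //; apply: E; exact: psiA.
have /asboolP[/= + _] : R (exist _ (_, _) phi'P) (exist _ (A, phi) Aphi).
  apply: Amax; apply/asboolP; split=> /= [x|s sA]; first by left.
  by rewrite /phi' asboolT.
have A0 : A (phi [::]) by exact: Aphi.1.
move=> /(_ (l (phi [::])) (or_intror _)) H.
by case: (lA _ A0); apply: H; exists (phi [::]).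
Qed.

(** * Clopen sets and partitions *)

Lemma sub_compact_clopen (X : topologicalType) (O : set X) (x : X) :
  zero_dim_space X -> locally_compact [set: X] -> open O -> O x ->
  exists K, [/\ clopen K, compact K, K `<=` O & K x].
Proof.
move=> [_ [_ clbase]] lcX Oo Ox.
have [C Cx [Cc _]] := lcX x I.
have {}Cx : nbhs x C.
  by apply: filterS (Cx : nbhs x [set y | [set: X] y -> C y]) => y; exact.
have [K [Kc Kx] KOC] := clbase x _ (filterI (open_nbhs_nbhs (conj Oo Ox)) Cx).
exists K; split=> // [|y /KOC[]//].
by apply: (subclosed_compact Kc.2 Cc) => y /KOC[].
Qed.

(** The complement is open because it can be described inside each piece, where
    at most one of the sets [K i] is removed. *)
Lemma clopen_bigcup_partition (X : topologicalType) (I : Type)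
    (U K : I -> set X) (S : set I) :
  clopen_partition U -> (forall i, clopen (K i)) ->
  (forall i, K i `<=` U i) -> clopen (\bigcup_(i in S) K i).
Proof.
move=> [Uc _ Utriv UT] Kc KU; split.
  by apply: bigcup_open => i _; exact: (Kc i).1.
rewrite -openC.
suff -> : ~` (\bigcup_(i in S) K i) =
    \bigcup_i (U i `&` ~` (if `[< S i >] then K i else set0)).
  apply: bigcup_open => i _; apply: openI; first exact: (Uc i).1.
  by rewrite openC; case: ifP => _; [exact: (Kc i).2|exact: closed0].
apply/seteqP; split=> [x nx|x [i _ [Uix nKx]] [j Sj Kjx]].
  have : (\bigcup_i U i) x by rewrite UT.
  move=> [i _ Uix]; exists i => //; split=> //.
  by case: asboolP => // Si Kix; apply: nx; exists i.
apply: nKx; suff -> : i = j by rewrite asboolT.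
by apply: Utriv => //; exists x; split=> //; exact: KU.
Qed.

(** If [g] is the absolute value of an unbounded function, take points along
    which [g] increases by more than 1 at each step. Clopen neighbourhoods of
    them on which [g] varies by less than 1/2 are disjoint and locally finite.
    All of them but the first, together with the complement of their union,
    form the partition; the first one is left out so that this complement is
    nonempty. *)
Lemma unbounded_partition (R : realType) (X : topologicalType) :
  zero_dim_space X -> ~ pseudocompact R X ->
  exists V : nat -> set X, clopen_partition V.
Proof.
move=> [_ [_ clbase]] /existsNP[f /not_implyP[fcont fnb]].
pose g (x : X) : R := `|f x|%R.
have gcont : continuous g.
  by move=> x; apply: cvg_norm; exact: fcont.
have gunb M : exists x, (M < g x)%R.
  apply: contrapT => /forallNP gM; apply: fnb.
  exists M; split=> [|N MN x _]; first exact: num_real.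
  by apply: le_trans (ltW MN); rewrite leNgt; apply/negP/gM.
have [x0 _] := gunb 0%R.
have [y [_ yS]] : {y : nat -> X | y 0 = x0 /\
    forall n, (g (y n) + 1 < g (y n.+1))%R}.
  apply: (@dependent_choice X (fun x z => (g x + 1 < g z)%R)) => x.
  exact/cid.
have ylt m n : (m < n)%N -> (g (y m) + 1 < g (y n))%R.
  elim: n => // n IH; rewrite ltnS leq_eqVlt => /orP[/eqP ->|/IH {}IH] //.
  by have := yS n; lra.
have yge n : (n%:R <= g (y n))%R.
  elim: n => [|n IH]; first exact: normr_ge0.
  by rewrite -natr1; have := yS n; lra.
have gnbhs x : nbhs x [set z | (`|g x - g z| < 2^-1)%R].
  by have /cvgr_dist_lt := gcont x; apply; rewrite invr_gt0.
have GP n : {G | clopen G /\ G (y n) /\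
    forall z, G z -> (`|g z - g (y n)| < 2^-1)%R}.
  apply: cid.
  have /clbase[G [Gc Gy] Gsub] := gnbhs (y n).
  exists G; split=> //; split=> // z /Gsub /=.
  by rewrite distrC.
pose G n := sval (GP n).
have Gc n : clopen (G n) by case: (svalP (GP n)).
have Gy n : G n (y n) by case: (svalP (GP n)) => _ [].
have Gd n z : G n z -> (`|g z - g (y n)| < 2^-1)%R.
  by case: (svalP (GP n)) => _ [_]; exact.
have Gdisj m n z : (m < n)%N -> G m z -> G n z -> False.
  move=> /ylt mn /Gd + /Gd; rewrite !ltr_norml => /andP[? ?] /andP[? ?]; lra.
pose E := \bigcup_m G m.+1.
have Eo : open E by apply: bigcup_open => m _; exact: (Gc _).1.
(* Near a point of bounded [g], only finitely many of the [G m] matter. *)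
have Ec : closed E.
  rewrite -openC openE => x nEx.
  have [N xN] : exists N : nat, (g x + 1 < N%:R)%R.
    by exists (Num.truncn (g x + 1)).+1; exact: truncnS_gt.
  have FNc : closed (\bigcup_(m in `I_N) G m.+1).
    by apply: closed_bigcup => // m _; exact: (Gc _).2.
  have xF : nbhs x (~` (\bigcup_(m in `I_N) G m.+1)).
    apply: open_nbhs_nbhs; split; first by rewrite openC.
    by move=> [m _ Gx]; apply: nEx; exists m.
  apply: filterS (filterI (gnbhs x) xF) => z [/= zx zF] [m _ Gz].
  apply: zF; exists m => //=.
  rewrite -(ltr_nat R).
  have := yge m.+1; rewrite -[(m.+1%:R)%R]natr1.
  by move: zx (Gd _ _ Gz); rewrite !ltr_norml => /andP[? ?] /andP[? ?]; lra.
exists (fun n => if n is 0 then ~` E else G n); split.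
- by case=> [|n]; [exact: clopenC|exact: Gc].
- case=> [|n]; [exists (y 0)|by exists (y n.+1)].
  by move=> [m _]; exact: Gdisj (Gy 0).
- move=> m n _ _ [z []].
  have EG k : ~ (~` E `&` G k.+1) z by move=> [nE Gz]; apply: nE; exists k.
  case: m n => [|m] [|n] //.
  + by move=> ? ?; case: (EG n).
  + by move=> ? ?; case: (EG m).
  + by case: (ltngtP m n) => [mn|nm|-> //] /[swap] Gm Gn; exfalso;
      [apply: Gdisj Gn Gm|apply: Gdisj Gm Gn].
- apply/seteqP; split=> // x _.
  have [[m _ Gx]|nEx] := pselect (E x); first by exists m.+1.
  by exists 0.
Qed.

(** * Clopen sets of the compactification *)

Lemma embedding_continuous (X B : topologicalType) (e : X -> B) :
  topological_embedding e -> continuous e.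
Proof. by move=> [_ eP]; apply/continuousP => V Vo; apply/eP; exists V. Qed.

Lemma clopen_extension (X B : topologicalType) (e : X -> B) (A : set X) :
  banaschewski_compactification e -> clopen A ->
  exists2 W : set B, clopen W & e @^-1` W = A.
Proof.
move=> [_ _ _ _ ext] [Ao Ac].
have [|g gcont gE] := ext (fun x => `[< A x >]).
  move=> x; apply: cvg_near_cst.
  have [Ax|nAx] := pselect (A x).
    apply: filterS (open_nbhs_nbhs (conj Ao Ax)) => y Ay.
    by rewrite !asboolT.
  have /filterS : nbhs x (~` A).
    by apply: open_nbhs_nbhs; split=> //; rewrite openC.
  by apply => y nAy; rewrite !asboolF.
exists (g @^-1` [set true]).
  apply: preimage_clopen gcont.
  by split; [exact: discrete_open|exact: discrete_closed].
by apply/seteqP; split=> x /=; rewrite gE => /asboolP.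
Qed.

(** The clopen ultrafilter of a point of [X] consists of clopen sets containing
    that point. *)
Lemma range_sub_upsilon0 (X B : topologicalType) (e : X -> B) :
  topological_embedding e -> range e `<=` upsilon0 e.
Proof.
move=> [_ eP] _ [x _ <-] F Fsub _; exists x => A /Fsub [[_ Ac] Ax].
apply: contrapT => nAx.
have /eP[V Vo VA] : open (~` A) by rewrite openC.
have [|_ [[a Aa <-] Va]] := Ax V.
  apply: open_nbhs_nbhs; split=> //.
  by rewrite -[V (e x)]/((e @^-1` V) x) VA.
by have : (e @^-1` V) a by []; rewrite VA; exact.
Qed.

(** The image of [C] is closed, so what is left of [O] outside of it is an open
    set missing the dense range, hence is empty. *)
Lemma open_sub_compact_image (X B : topologicalType) (e : X -> B)
    (O : set B) (C : set X) :
  hausdorff_space B -> continuous e -> dense (range e) ->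
  open O -> compact C -> e @^-1` O `<=` C -> O `<=` e @` C.
Proof.
move=> hB ec eD Oo Cc OC p Op; apply: contrapT => neC.
have Co : open (~` (e @` C)).
  rewrite openC; apply: compact_closed => //.
  by apply: continuous_compact => //; exact: continuous_subspaceT.
have [||q [[Oq nq] [x _ ex]]] := eD (O `&` ~` (e @` C)).
- by exists p.
- exact: openI.
by apply: nq; exists x => //; apply: OC; rewrite /= ex.
Qed.

(** The point is a cluster point of a sequence of [x n] in [F n]: it is adherent
    to every [F n], and the countable family of the [F n] witnesses that it is
    outside [upsilon0 e]. *)
Lemma remainder_point (X B : topologicalType) (e : X -> B)
    (F : nat -> set X) (W : set B) :
  compact [set: B] -> closed W -> e @` F 0 `<=` W ->
  (forall n, clopen (F n)) -> (forall n, F n !=set0) ->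
  (forall m n, (m <= n)%N -> F n `<=` F m) ->
  \bigcap_n F n = set0 ->
  exists2 p, W p & ~ upsilon0 e p.
Proof.
move=> cB Wc FW Fc F0 Fdecr Fcap.
have [x xF] : {x : nat -> X & forall n, F n (x n)}.
  by exists (fun n => sval (cid (F0 n))) => n; exact: (svalP (cid (F0 n))).
have [p [_ pcl]] := cB ((e \o x) @ \oo) _ filterT.
have pF n : closure (e @` F n) p.
  move=> V Vp; apply: pcl => //.
  exists n => // m /= nm; exists (x m) => //.
  exact: Fdecr nm _ (xF m).
exists p.
  by have := closureS FW (pF 0); rewrite -(closure_id W).1.
move=> /(_ (range F))[|//|z zF].
- by move=> _ [n _ <-].
- exact: card_image_le.
- suff : (\bigcap_n F n) z by rewrite Fcap.
  by move=> n _; apply: zF; exists n.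
Qed.

(** * Cellularity of the remainder *)

Lemma card_le_cellularity (Y : topologicalType) (T : Type) (V : T -> set Y) :
  (forall t, open (V t)) -> (forall t, V t !=set0) ->
  trivIset [set: T] V -> [set: T] #<= cellularity Y.
Proof.
move=> Vo V0 Vtriv.
have [+ _] := cellularityP Y.
move=> /(_ (range V)) H; apply: card_le_trans (H _).
  have /card_eqPle[] // : range V #= [set: T].
  apply: inj_card_eq => s t _ _ st; apply: Vtriv => //.
  by have [y Vy] := V0 s; exists y; split=> //; rewrite -st.
split=> [_ [t _ <-]|_ _ [s _ <-] [t _ <-] st]; first by split.
by congr V; exact: Vtriv.
Qed.

Lemma mkseq_inj (J : Type) (f h : nat -> J) m n :
  mkseq f m = mkseq h n -> m = n /\ forall k, (k < m)%N -> f k = h k.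
Proof.
move=> E; have mn : m = n by rewrite -(size_mkseq f m) E size_mkseq.
split=> // k km; rewrite -(nth_mkseq (f k) f km) E nth_mkseq //.
by rewrite -mn.
Qed.

(** The almost disjoint family of branches: the trace of the extension [W f] is
    nonempty outside [upsilon0 e], and two such extensions meet inside
    [range e] only. The types [I] and [J] are distinct so that a partition
    indexed by [nat] can serve for any finite [J]. *)
Lemma remainder_cellularity (X B : topologicalType) (e : X -> B) (D : set B)
    (I J : Type) (U : I -> set X) (iota : seq J -> I) :
  zero_dim_space X -> locally_compact [set: X] -> clopen_partition U ->
  banaschewski_compactification e -> range e `<=` D -> D `<=` upsilon0 e ->
  injective iota -> [set: nat -> J] #<= cellularity (set_type (~` D)).
Proof.
move=> X0 Xlc Upart hB eD Dups iinj.
have [Bc [hausB _] eemb edense _] := hB.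
have econt := embedding_continuous eemb.
have [Uc U0 Utriv _] := Upart.
have KP i : {K | [/\ clopen K, compact K, K `<=` U i & K !=set0]}.
  apply: cid; have [x Ux] := U0 i.
  have [K [? ? ? ?]] := sub_compact_clopen X0 Xlc (Uc i).1 Ux.
  by exists K; split=> //; exists x.
pose K i := sval (KP i).
have Kc i : clopen (K i) by case: (svalP (KP i)).
have Kcpt i : compact (K i) by case: (svalP (KP i)).
have KU i : K i `<=` U i by case: (svalP (KP i)).
have K0 i : K i !=set0 by case: (svalP (KP i)).
have Kdisj i j x : K i x -> K j x -> i = j.
  by move=> /KU Ui /KU Uj; apply: Utriv => //; exists x.
pose k (f : nat -> J) n := iota (mkseq f n).
have kE f h m n x : K (k f m) x -> K (k h n) x ->
    m = n /\ forall j, (j < m)%N -> f j = h j.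
  by move=> Kf /(Kdisj _ _ _ Kf) /iinj /mkseq_inj.
(* [A f 0] is the clopen set of the branch [f]; the sets [A f n], for larger
   [n], witness the failure of the countable intersection property. *)
pose A f n := \bigcup_(i in k f @` [set m | (n <= m)%N]) K i.
have Ac f n : clopen (A f n) by exact: clopen_bigcup_partition Upart Kc KU.
have AP f n x : A f n x <-> exists2 m, (n <= m)%N & K (k f m) x.
  split=> [[_ [m nm <-] Kx]|[m nm Kx]]; first by exists m.
  by exists (k f m) => //; exists m.
have WP f : {W : set B | clopen W /\ e @^-1` W = A f 0}.
  by apply: cid; have [W] := clopen_extension hB (Ac f 0); exists W.
pose W f := sval (WP f).
have Wc f : clopen (W f) by exact: (svalP (WP f)).1.
have WA f : e @^-1` W f = A f 0 by exact: (svalP (WP f)).2.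
apply: (card_le_cellularity (V := fun f => set_val @^-1` W f)) => [f|f|].
- exact: (continuousP _).1 (@initial_continuous _ _ _) _ (Wc f).1.
- have [|||||||p Wp pups] := @remainder_point _ _ e (A f) (W f).
  + exact: Bc.
  + exact: (Wc f).2.
  + by move=> _ [x + <-]; rewrite -WA.
  + exact: Ac.
  + move=> n; have [x Kx] := K0 (k f n); exists x.
    by apply/AP; exists n.
  + move=> m n mn x /AP[j nj Kx]; apply/AP; exists j => //.
    exact: leq_trans nj.
  + apply/seteqP; split=> // x Ax.
    have /AP[m _ Km] := Ax 0 Logic.I.
    have /AP[n mn Kn] := Ax m.+1 Logic.I.
    by have [E _] := kE _ _ _ _ _ Km Kn; rewrite E ltnn in mn.
  have pD : ~ D p by move=> /Dups.
  by exists (SigSub (mem_set (pD : (~` D) p))).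
- move=> f h _ _ [[p /= pD] [/= Wf Wh]]; apply: contrapT => fh.
  have [j fhj] : exists j, f j <> h j.
    by apply: contrapT => /forallNP E; apply: fh; apply: funext => j;
      apply: contrapT; exact: E.
  have /eD/(set_mem pD) [] // : range e p.
  have : (W f `&` W h) p by [].
  suff: W f `&` W h `<=` e @` (\big[setU/set0]_(n < j.+1) K (k f n)).
    by move=> sub /sub[x _ <-]; exists x.
  apply: open_sub_compact_image => //.
  + by apply: openI; [exact: (Wc f).1|exact: (Wc h).1].
  + by apply: bigsetU_compact.
  rewrite preimage_setI !WA => x [/AP[m _ Km] /AP[n _ Kn]].
  have [_ E] := kE _ _ _ _ _ Km Kn.
  rewrite -(bigcup_mkord _ (fun n => K (k f n))); exists m => //=.
  by rewrite ltnNge; apply/negP => /E.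
Qed.

Lemma finite_seq_inj (I : Type) :
  finite_set [set: I] -> exists f : seq I -> nat, injective f.
Proof.
move=> /finite_set_countable countI.
have [h [_ hinj]] := card_le_inj_fun (fun=> 0) countI.
exists (fun s => pickle (map h s)) => s t /(pcan_inj pickleK).
by apply: inj_map => x y; exact: hinj.
Qed.

Theorem theorem3p12 (R : realType) (X : topologicalType)
    (hX0 : zero_dim_space X)
    (hXlc : locally_compact [set: X])
    (hXnp : ~ pseudocompact R X)
    (I : Type) (U : I -> set X) (hU : clopen_partition U)
    (B : topologicalType) (e : X -> B)
    (hB : banaschewski_compactification e) :
  [set: nat -> I] #<= cellularity (set_type (~` upsilon0 e)) /\
  [set: nat -> I] #<= cellularity (set_type (~` range e)).
Proof.
have eups : range e `<=` upsilon0 e.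
  by case: hB => _ _ eemb _ _; exact: range_sub_upsilon0.
have [finI|/infinite_seq_inj[phi phi_inj]] := pselect (finite_set [set: I]).
  have [V hV] := unbounded_partition hX0 hXnp.
  have [phi phi_inj] := finite_seq_inj finI.
  by split; exact: remainder_cellularity hX0 hXlc hV hB _ _ phi_inj.
by split; exact: remainder_cellularity hX0 hXlc hU hB _ _ phi_inj.
Qed.
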